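(* Let $\kappa$ be an uncountable strong limit cardinal and let $f,g\colon C\to D$ be two morphisms in $\mathbf{Cmp}_\kappa$, where $C=(X_C,\mathscr C_C)$ and $D=(X_D,\mathscr C_D)$. (1) The equalizer $\operatorname{Eq}(f,g)$ of $f$ and $g$ exists in $\mathbf{Cmp}_\kappa$ and in $\mathbf{Cmp}$ and is given by $$\bigl(X:=\{x\in X_C\mid f(x)=g(x)\},\ \ \mathscr C:=\{K\cap X\mid K\in\mathscr C_C\}=\{K\in\mathscr C_C\mid K\subseteq X\}\bigr).$$ The associated space $(\operatorname{Eq}(f,g))_{\mathrm{top}}$ agrees with the equalizer of $(f)_{\mathrm{top}}$ and $(g)_{\mathrm{top}}$ in $\mathbf{CGWH}$. (2) The coequalizer $\operatorname{Coeq}(f,g)$ of $f$ and $g$ exists in $\mathbf{Cmp}_\kappa$ and in $\mathbf{Cmp}$ and is given by $$\bigl(X:=X_D/E,\ \ \mathscr C:=\pi(\mathscr C_D)=\{\pi(K)\mid K\in\mathscr C_D\}\bigr),$$ where $E\subseteq X_D\times X_D$ is the smallest closed equivalence relation containing all pairs $(f(x),g(x))$, $x\in X_C$, the set $X_D\times X_D$ carrying the topology induced by the product compactology of $D\times D$, and where $\pi\colon X_D\to X$ is the canonical projection. The associated space $(\operatorname{Coeq}(f,g))_{\mathrm{top}}$ agrees with the coequalizer of $(f)_{\mathrm{top}}$ and $(g)_{\mathrm{top}}$ in $\mathbf{CGWH}$.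
   Context: ''Compact'' always means quasi-compact and Hausdorff. A compactological set is a triple $(X,\mathscr C,(\tau_K)_{K\in\mathscr C})$ where $X$ is a set, $\mathscr C\subseteq\mathcal P(X)$ is a non-empty collection (the compactology), and each $\tau_K$ is a topology on $K$ such that $(K,\tau_K)$ is compact and: (a) $\bigcup\mathscr C=X$; (b) for $K_1,K_2\in\mathscr C$ there is $K_3\in\mathscr C$ with $K_1\cup K_2\subseteq K_3$; (c) $\tau_{K_2}=\tau_{K_1}|_{K_2}$ for $K_2\subseteq K_1$ in $\mathscr C$; (d) compact subsets of $(K_1,\tau_{K_1})$, $K_1\in\mathscr C$, belong to $\mathscr C$. The $\tau_K$ are determined by $\mathscr C$ (the open sets of $K$ are exactly the $K\setminus K'$ with $K'\in\mathscr C$), so one writes $(X,\mathscr C)$. The topology induced by $\mathscr C$ on $X$ is the final topology with respect to the inclusions $(K,\tau_K)\hookrightarrow X$, $K\in\mathscr C$. Morphisms are maps $f\colon X\to X'$ with $f(K)\in\mathscr C'$ and $f|_K\colon (K,\tau_K)\to (f(K),\tau_{f(K)})$ continuous for all $K\in\mathscr C$. This is the category $\mathbf{Cmp}$; $\mathbf{Cmp}_\kappa$ is the full subcategory of those $(X,\mathscr C)$ with $|K|<\kappa$ for all $K\in\mathscr C$. The product compactology of $D\times D$ on $X_D\times X_D$ consists of all intersections over non-empty collections of finite unions of sets $K_1\times K_2$ with $K_1,K_2\in\mathscr C_D$ (it is the compactology of the product in $\mathbf{Cmp}$). A space $X$ is weak Hausdorff if $f(S)$ is closed for every compact $S$ and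 continuous $f\colon S\to X$, and compactly generated if $F\subseteq X$ is closed iff $f^{-1}(F)$ is closed for all such $f$. $\mathbf{CGWH}$ is the category of compactly generated weak Hausdorff spaces with continuous maps. The functor $(-)_{\mathrm{top}}\colon\mathbf{Cmp}\to\mathbf{CGWH}$ sends $(X,\mathscr C)$ to $X$ with the topology induced by $\mathscr C$. *)

(* Defs.v *)
From HB Require Import structures.
From mathcomp Require Import all_boot all_classical.
From mathcomp Require Import topology.

Set Implicit Arguments.
Unset Strict Implicit.
Unset Printing Implicit Defensive.

Local Open Scope classical_set_scope.

(* A cardinal is represented by any type having that cardinality. *)
Definition card_lt (A B : Type) : Prop :=
  ([set: A] #<= [set: B])%card /\ ~ ([set: B] #<= [set: A])%card.

Definition uncountable_card (kappa : Type) : Prop := ~ countable [set: kappa].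

Definition strong_limit_card (kappa : Type) : Prop :=
  forall lambda : Type, card_lt lambda kappa -> card_lt (set lambda) kappa.

Record category := Category {
  obj :> Type;
  hom : obj -> obj -> Type;
  idm : forall x, hom x x;
  compm : forall x y z, hom y z -> hom x y -> hom x z;
  compm_idl : forall x y (f : hom x y), compm (idm y) f = f;
  compm_idr : forall x y (f : hom x y), compm f (idm x) = f;
  compmA : forall x y z t (h : hom z t) (g : hom y z) (f : hom x y),
    compm h (compm g f) = compm (compm h g) f
}.
Arguments hom {_}.
Arguments compm {_ _ _ _}.

Definition full_subcategory (A : category) (P : A -> Prop) : category :=
  @Category {x : A | P x} (fun x y => hom (sval x) (sval y))
    (fun x => idm (sval x)) (fun x y z g f => compm g f)
    (fun x y f => compm_idl f) (fun x y f => compm_idr f)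
    (fun x y z t h g f => compmA h g f).

Record functor (A B : category) := Functor {
  fobj :> A -> B;
  fmor : forall x y, hom x y -> hom (fobj x) (fobj y);
  fmor1 : forall x, fmor (idm x) = idm (fobj x);
  fmorM : forall x y z (g : hom y z) (f : hom x y),
    fmor (compm g f) = compm (fmor g) (fmor f)
}.
Arguments fmor {_ _} _ {_ _}.

Definition is_equalizer (A : category) (x y : A) (f g : hom x y)
    (e : A) (i : hom e x) : Prop :=
  compm f i = compm g i /\
  forall (t : A) (h : hom t x), compm f h = compm g h ->
    exists! u : hom t e, compm i u = h.

Definition is_coequalizer (A : category) (x y : A) (f g : hom x y)
    (q : A) (p : hom y q) : Prop :=
  compm p f = compm p g /\
  forall (t : A) (h : hom y t), compm h f = compm h g ->
    exists! u : hom q t, compm u p = h.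

Definition compact_hausdorff (S : topologicalType) : Prop :=
  compact [set: S] /\ hausdorff_space S.

Definition weak_hausdorff (X : topologicalType) : Prop :=
  forall (S : topologicalType) (f : S -> X),
    compact_hausdorff S -> continuous f -> closed (range f).

Definition compactly_generated (X : topologicalType) : Prop :=
  forall F : set X, closed F <->
    forall (S : topologicalType) (f : S -> X),
      compact_hausdorff S -> continuous f -> closed (f @^-1` F).

Definition top_hom (X Y : topologicalType) := {f : X -> Y | continuous f}.

Lemma top_homP (X Y : topologicalType) (f g : top_hom X Y) :
  sval f =1 sval g -> f = g.
Proof. by case: f g => [f cf] [g cg] /= /funext fg; exact: eq_exist. Qed.

Lemma continuous_id (X : topologicalType) : continuous (@id X).
Proof. by move=> x. Qed.

Lemma continuous_comp_fun (X Y Z : topologicalType) (g : Y -> Z) (f : X -> Y) :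
  continuous g -> continuous f -> continuous (g \o f).
Proof. by move=> cg cf x; apply: continuous_comp; [exact: cf|exact: cg]. Qed.

Definition top_comp (X Y Z : topologicalType) (g : top_hom Y Z)
    (f : top_hom X Y) : top_hom X Z :=
  exist _ (sval g \o sval f) (continuous_comp_fun (svalP g) (svalP f)).

Definition Top : category.
Proof.
apply: (@Category topologicalType top_hom
  (fun X => exist _ id (@continuous_id X)) top_comp) => *; exact: top_homP.
Defined.

Definition CGWH : category :=
  @full_subcategory Top (fun X => compactly_generated X /\ weak_hausdorff X).

(* [Topological.axioms_ T] is the type of topologies on [T]. *)
Definition topology_on (T : Type) := Topological.axioms_ T.
Definition space (T : Type) (t : topology_on T) : topologicalType :=
  Topological.Pack t.

Definition set_incl (T : Type) (A B : set T) (AB : A `<=` B) (x : A) : B :=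
  exist _ (val x) (mem_set (AB _ (set_mem (valP x)))).

(* tau is indexed by the subtype of sets belonging to members, so it is only
   defined on those. Its restriction along K2 `<=` K1 is the subspace topology,
   i.e. the preimages under the inclusion of the open sets of K1. *)
Record compactology (X : choiceType) := Compactology {
  members :> set (set X);
  tau : forall K : members, topology_on (val K);
  members_neq0 : members !=set0;
  tau_compact : forall K : members, compact_hausdorff (space (tau K));
  members_cover : \bigcup_(K in members) K = [set: X];
  members_directed : forall K1 K2, members K1 -> members K2 ->
    exists2 K3, members K3 & K1 `|` K2 `<=` K3;
  tau_restrict : forall (K1 K2 : members) (sK : val K2 `<=` val K1),
    @open (space (tau K2)) =
    [set set_incl sK @^-1` U | U in @open (space (tau K1))];
  members_compact : forall (K : members) (A : set (space (tau K))),
    compact A -> members (val @` A)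
}.
Arguments tau {_} _ _.

Record compactological := Compactological {
  carrier :> choiceType;
  cplgy : compactology carrier
}.

(* g is the map f|_K : (K, tau_K) -> (f(K), tau_f(K)). *)
Definition cmp_morphism (X Y : compactological) (f : X -> Y) : Prop :=
  forall K : cplgy X, exists L : cplgy Y, f @` val K = val L /\
    exists g : space (tau (cplgy X) K) -> space (tau (cplgy Y) L),
      (forall x, val (g x) = f (val x)) /\ continuous g.

Definition cmp_hom (X Y : compactological) := {f : X -> Y | cmp_morphism f}.

Lemma cmp_homP (X Y : compactological) (f g : cmp_hom X Y) :
  sval f =1 sval g -> f = g.
Proof. by case: f g => [f cf] [g cg] /= /funext fg; exact: eq_exist. Qed.

Lemma cmp_morphism_id (X : compactological) : cmp_morphism (@id X).
Proof.
move=> K; exists K; rewrite image_id; split=> //.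
by exists id; split=> // x.
Qed.

Lemma cmp_morphism_comp (X Y Z : compactological) (g : Y -> Z) (f : X -> Y) :
  cmp_morphism g -> cmp_morphism f -> cmp_morphism (g \o f).
Proof.
move=> mg mf K.
have [L [fKL [f' [f'E cf']]]] := mf K.
have [M [gLM [g' [g'E cg']]]] := mg L.
exists M; split; first by rewrite -gLM -fKL image_comp.
exists (g' \o f'); split; first by move=> x; rewrite /= g'E f'E.
exact: continuous_comp_fun.
Qed.

Definition cmp_comp (X Y Z : compactological) (g : cmp_hom Y Z)
    (f : cmp_hom X Y) : cmp_hom X Z :=
  exist _ (sval g \o sval f) (cmp_morphism_comp (svalP g) (svalP f)).

Definition Cmp : category.
Proof.
apply: (@Category compactological cmp_hom
  (fun X => exist _ id (@cmp_morphism_id X)) cmp_comp) => *; exact: cmp_homP.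
Defined.

Definition cmp_small (kappa : Type) (X : Cmp) : Prop :=
  forall K : cplgy X, card_lt (val K) kappa.

Definition Cmp_lt (kappa : Type) : category :=
  full_subcategory (cmp_small kappa).

(* X with the final topology for the inclusions of the (K, tau_K). *)
Definition induced_space (X : choiceType) (C : compactology X) : Type := X.

Section InducedTopology.
Variables (X : choiceType) (C : compactology X).

Definition induced_open : set_system (induced_space C) :=
  [set U | forall K : C, @open (space (tau C K)) (val @^-1` U)].

Local Lemma induced_openT : induced_open setT.
Proof. by move=> K; rewrite preimage_setT; exact: openT. Qed.

Local Lemma induced_openI : setI_closed induced_open.
Proof. by move=> A B oA oB K; rewrite preimage_setI; exact: openI. Qed.

Local Lemma induced_open_bigU (I : Type) (f : I -> set (induced_space C)) :
  (forall i, induced_open (f i)) -> induced_open (\bigcup_i f i).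
Proof.
by move=> oF K; rewrite preimage_bigcup; apply: bigcup_open => i _; exact: oF.
Qed.

HB.instance Definition _ := Choice.copy (induced_space C) X.
HB.instance Definition _ := isOpenTopological.Build (induced_space C)
  induced_openT induced_openI induced_open_bigU.

End InducedTopology.

Section Embedding.
Variables (S T : topologicalType) (f : S -> T).
Hypothesis f_initial : @open S = [set f @^-1` V | V in @open T].

Lemma embedding_continuous : continuous f.
Proof. by apply/continuousP => V oV; rewrite f_initial; exists V. Qed.

Lemma embedding_lift (Z : topologicalType) (g : Z -> S) :
  continuous (f \o g) -> continuous g.
Proof.
move=> /continuousP cfg; apply/continuousP => U.
rewrite f_initial => -[V oV <-]; exact: cfg.
Qed.

Lemma embedding_compact (A : set S) : compact (f @` A) -> compact A.
Proof.
move=> cA F PF FA.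
have fF B : F B -> (f @ F) (f @` B).
  by rewrite /fmap /=; apply: filterS => x Bx; exists x.
have [_ [[a Aa <-] clFa]] := cA (f @ F) _ (fF _ FA).
exists a; split=> // G N FG; rewrite nbhsE => -[U [oU Ua] UN].
move: oU Ua UN; rewrite f_initial => -[V oV <-] Va UN.
have [_ [[x Gx <-] Vx]] := clFa _ _ (fF _ FG) (open_nbhs_nbhs (conj oV Va)).
by exists x; split=> //; exact: UN.
Qed.

End Embedding.

Section InducedTheory.
Variables (X : choiceType) (C : compactology X).
Local Notation T := (induced_space C).
Local Notation sp K := (space (tau C K)).

Lemma induced_openP (U : set T) :
  open U <-> forall K : C, @open (sp K) (val @^-1` U).
Proof. by []. Qed.

Lemma induced_closedP (F : set T) :
  closed F <-> forall K : C, @closed (sp K) (val @^-1` F).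
Proof.
rewrite -openC induced_openP; split=> oF K; move: (oF K).
  by rewrite preimage_setC openC.
by rewrite preimage_setC openC.
Qed.

Lemma val_continuous (K : C) : continuous (val : sp K -> T).
Proof. by apply/continuousP => U /induced_openP. Qed.

Lemma set_incl_continuous (K L : C) (KL : val K `<=` val L) :
  continuous (set_incl KL : sp K -> sp L).
Proof. by apply: embedding_continuous; exact: (tau_restrict KL). Qed.

Lemma memberC (K : set X) (CK : members C K) : {L : C | val L = K}.
Proof. by exists (exist _ K (mem_set CK)). Qed.

Lemma member_closed (K : C) : closed (val K : set T).
Proof.
apply/induced_closedP => L.
have [M0 CM] := members_directed (set_mem (valP K)) (set_mem (valP L)).
have [M <-] := memberC CM; rewrite subUset => -[KM LM].
have [cM hM] := tau_compact M.
have cK : @compact (sp M) (range (set_incl KM : sp K -> sp M)).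
  apply: continuous_compact; last by case: (tau_compact K).
  by apply: continuous_subspaceT; exact: set_incl_continuous.
rewrite (_ : _ @^-1` _ = set_incl LM @^-1` range (set_incl KM)).
  move/continuous_closedP: (@set_incl_continuous _ _ LM); apply.
  exact: compact_closed.
apply/seteqP; split=> x /=.
  by move=> Kx; exists (exist _ (val x) (mem_set Kx)) => //; exact: val_inj.
by move=> [y _ /(congr1 val) /= <-]; exact: set_mem (valP y).
Qed.

Lemma closed_memberT (A : set T) : members C A -> closed A.
Proof. by move=> /memberC[K <-]; exact: member_closed. Qed.

Lemma closed_member (K : C) (A : set (sp K)) : closed A -> members C (val @` A).
Proof.
move=> cA; apply: members_compact.
exact: subclosed_compact cA (tau_compact K).1 (@subsetT _ _).
Qed.

Lemma val_initial (K : C) :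
  @open (sp K) = [set val @^-1` V | V in @open T].
Proof.
apply/seteqP; split=> U; last by move=> [V /induced_openP oV <-]; exact: (oV K).
move=> oU; have cU := closed_member (open_closedC oU).
exists (~` [set (val x : T) | x in ~` U]).
  rewrite openC; exact: closed_memberT.
apply/seteqP; split=> x /=.
  by apply: contra_notP => nUx; exists x.
by move=> Ux [y nUy /val_inj yx]; apply: nUy; rewrite yx.
Qed.

Lemma induced_weak_hausdorff : weak_hausdorff T.
Proof.
move=> S f [cS hS] cf; apply/induced_closedP => K.
apply: compact_closed; first by case: (tau_compact K).
apply: (embedding_compact (val_initial K)).
rewrite (_ : _ @` _ = f @` (f @^-1` (val K : set T))); last first.
  apply/seteqP; split=> [_ [x [s _ fs] <-]|_ [s Ks <-]].
    exists s; rewrite /= fs //; exact: set_mem (valP x).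
  by exists (exist _ (f s) (mem_set Ks)) => //; exists s.
apply: continuous_compact; first exact: continuous_subspaceT.
apply: subclosed_compact cS (@subsetT _ _).
by move/continuous_closedP: cf; apply; exact: member_closed.
Qed.

Lemma induced_compactly_generated : compactly_generated T.
Proof.
move=> F; split=> [cF S f _ /continuous_closedP|cF]; first exact.
apply/induced_closedP => K; apply: cF; first exact: tau_compact.
exact: val_continuous.
Qed.

End InducedTheory.

Definition top_obj (X : Cmp) : CGWH :=
  exist _ (induced_space (cplgy X) : topologicalType)
    (conj (@induced_compactly_generated _ (cplgy X))
          (@induced_weak_hausdorff _ (cplgy X))).

Lemma cmp_morphism_continuous (X Y : compactological) (f : X -> Y) :
  cmp_morphism f ->
  continuous (f : induced_space (cplgy X) -> induced_space (cplgy Y)).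
Proof.
move=> mf; apply/continuousP => U /induced_openP oU; apply/induced_openP => K.
have [L [_ [g [gE /continuousP cg]]]] := mf K.
have := cg _ (oU L); congr (open _).
by apply/seteqP; split=> x; rewrite /= gE.
Qed.

Definition top_map (X Y : Cmp) (f : hom X Y) : hom (top_obj X) (top_obj Y) :=
  exist _ (sval f) (cmp_morphism_continuous (svalP f)).

Definition to_top : functor Cmp CGWH.
Proof.
by apply: (@Functor Cmp CGWH top_obj top_map) => *; exact: top_homP.
Defined.

Lemma continuous_fst (X Y : topologicalType) : continuous (@fst X Y).
Proof. by move=> x; exact: cvg_fst. Qed.

Lemma continuous_snd (X Y : topologicalType) : continuous (@snd X Y).
Proof. by move=> x; exact: cvg_snd. Qed.

Section Product.
Variables (X1 X2 : choiceType) (C1 : compactology X1) (C2 : compactology X2).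

Definition rectangle_union (A : set (X1 * X2)) : Prop :=
  exists (n : nat) (K1 : 'I_n -> C1) (K2 : 'I_n -> C2),
    A = \bigcup_i (val (K1 i) `*` val (K2 i)).

Definition prod_members : set (set (X1 * X2)) :=
  [set L | exists2 F : set (set (X1 * X2)), F !=set0 &
    F `<=` rectangle_union /\ L = \bigcap_(A in F) A].

Local Notation P := (induced_space C1 * induced_space C2)%type.

(* L gets the subspace topology of the topological product of the two induced
   spaces.  Each K in C carries the subspace topology of its induced space
   (val_initial), so on a rectangle K1 `*` K2 this is the product topology of
   (K1, tau K1) and (K2, tau K2). *)
Definition prod_tau (L : prod_members) : topology_on (val L) :=
  Topological.on (set_type (val L : set P)).


Lemma prod_open (L : prod_members) :
  @open (space (prod_tau L)) = [set val @^-1` U | U in @open P].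
Proof. by []. Qed.

Definition rect (K1 : C1) (K2 : C2) : set P := val K1 `*` val K2.

Lemma members_rect (K1 : C1) (K2 : C2) : rectangle_union (rect K1 K2).
Proof.
exists 1, (fun=> K1), (fun=> K2).
by apply/seteqP; split=> [x Kx|x [i _] //]; exists ord0.
Qed.

Lemma prod_members_union (A : set (X1 * X2)) :
  rectangle_union A -> prod_members A.
Proof.
move=> rA; exists [set A]; first by exists A.
by split=> [_ -> //|]; rewrite bigcap_set1.
Qed.

Lemma rectangle_union_sub (A : set (X1 * X2)) : rectangle_union A ->
  exists (K1 : C1) (K2 : C2), A `<=` rect K1 K2.
Proof.
move=> [n [K1 [K2 ->]]].
have sub (X : choiceType) (C : compactology X) (K : 'I_n -> C) :
    exists L : C, forall i, val (K i) `<=` val L.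
  have [L0 CL0] := members_neq0 C.
  have : forall m, m <= n -> exists L : C, forall i : 'I_n,
      i < m -> val (K i) `<=` val L.
    elim=> [_|m IH mn]; first by have [L _] := memberC CL0; exists L.
    have [L HL] := IH (ltnW mn).
    have [M0 CM] := members_directed (set_mem (valP L))
      (set_mem (valP (K (Ordinal mn)))).
    have [M <-] := memberC CM; rewrite subUset => -[LM KM]; exists M => i.
    rewrite ltnS leq_eqVlt => /orP[/eqP im|/HL]; last by move/subset_trans; apply.
    by rewrite (_ : i = Ordinal mn) //; exact: val_inj.
  by move=> /(_ n (leqnn n))[L HL]; exists L => i; exact: HL.
have [L1 H1] := sub _ _ K1; have [L2 H2] := sub _ _ K2.
by exists L1, L2 => x [i _ [/H1 ? /H2]].
Qed.

Lemma prod_members_sub (L : set (X1 * X2)) : prod_members L ->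
  exists (K1 : C1) (K2 : C2), L `<=` rect K1 K2.
Proof.
move=> [F [A FA] [Fr ->]]; have [K1 [K2 AK]] := rectangle_union_sub (Fr _ FA).
by exists K1, K2; apply: subset_trans AK; exact: bigcap_inf.
Qed.

Lemma compact_val X (C : compactology X) (K : C) :
  compact (val K : set (induced_space C)).
Proof.
have <- : range (val : space (tau C K) -> induced_space C) = val K.
  apply/seteqP; split=> [_ [x _ <-]|x Kx]; first exact: set_mem (valP x).
  by exists (exist _ x (mem_set Kx)).
apply: continuous_compact; last by case: (tau_compact K).
exact/continuous_subspaceT/val_continuous.
Qed.

Lemma compact_rect (K1 : C1) (K2 : C2) : compact (rect K1 K2).
Proof. by apply: compact_setX; exact: compact_val. Qed.

Lemma closed_rect (K1 : C1) (K2 : C2) : closed (rect K1 K2).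
Proof.
rewrite (_ : rect _ _ = fst @^-1` (val K1) `&` snd @^-1` (val K2)) //.
apply: closedI.
  move/continuous_closedP: (@continuous_fst (induced_space C1) (induced_space C2)).
  by apply; exact: member_closed.
move/continuous_closedP: (@continuous_snd (induced_space C1) (induced_space C2)).
by apply; exact: member_closed.
Qed.

Lemma prod_members_closed (L : set P) : prod_members L -> closed L.
Proof.
move=> [F _ [Fr ->]]; apply: closed_bigI => A /Fr[n [K1 [K2 ->]]].
by apply: closed_bigcup => [|i _]; [exact: finite_finset|exact: closed_rect].
Qed.

Lemma hausdorff_sub_rect (L : set P) (K1 : C1) (K2 : C2) :
  L `<=` rect K1 K2 -> hausdorff_space (set_type L).
Proof.
move=> LK p q pq.
have cval : continuous (val : set_type L -> P) by exact: initial_continuous.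
have Lval (x : set_type L) : rect K1 K2 (val x) by apply/LK/set_mem/(valP x).
have step (S : topologicalType) (h : set_type L -> S) :
    continuous h -> hausdorff_space S -> h p = h q.
  move=> ch; apply=> A B Ahp Bhq.
  have [x [Ax Bx]] := pq _ _ (ch _ _ Ahp) (ch _ _ Bhq).
  by exists (h x).
apply: val_inj.
pose h1 (x : set_type L) : space (tau C1 K1) := exist _ (val x).1 (mem_set (Lval x).1).
pose h2 (x : set_type L) : space (tau C2 K2) := exist _ (val x).2 (mem_set (Lval x).2).
have ch1 : continuous h1.
  apply: (embedding_lift (val_initial K1)).
  exact: (continuous_comp_fun (@continuous_fst _ _) cval).
have ch2 : continuous h2.
  apply: (embedding_lift (val_initial K2)).
  exact: (continuous_comp_fun (@continuous_snd _ _) cval).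
have e1 := congr1 val (step _ h1 ch1 (tau_compact K1).2).
have e2 := congr1 val (step _ h2 ch2 (tau_compact K2).2).
by rewrite [LHS]surjective_pairing [RHS]surjective_pairing; congr pair.
Qed.

Lemma compact_sub_rect (M : set P) (K1 : C1) (K2 : C2) :
  M `<=` rect K1 K2 -> compact M -> prod_members M.
Proof.
move=> MK cM.
pose val' (x : set_type (rect K1 K2)) : P := val x.
have clM : closed (val' @^-1` M).
  apply: compact_closed; first exact: (@hausdorff_sub_rect _ K1 K2).
  apply: (@embedding_compact _ _ val') => //.
  rewrite (_ : _ @` _ = M) //; apply/seteqP; split=> [_ [x Mx <-] //|x Mx].
  by exists (exist _ x (mem_set (MK _ Mx))).
have sub (X : choiceType) (C : compactology X) (K : C) (U : set (induced_space C)) :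
    open U -> exists K' : C, val K' = val K `\` U.
  move=> oU; have := @closed_member _ _ K (val @^-1` ~` U).
  rewrite preimage_setC => /(_ (open_closedC (oU K))) /memberC[K' K'E].
  exists K'; rewrite K'E; apply/seteqP; split=> [_ [x nUx <-]|x [Kx nUx]].
    by split; [exact: set_mem (valP x)|].
  by exists (exist _ x (mem_set Kx)).
exists [set A | rectangle_union A /\ M `<=` A].
  by exists (rect K1 K2); split=> //; exact: members_rect.
split=> [A []//|]; apply/seteqP; split=> [z Mz A [_]|z zA]; first exact.
have Rz : rect K1 K2 z by apply: zA; split=> //; exact: members_rect.
apply: contrapT => nMz.
have : nbhs (exist _ z (mem_set Rz) : set_type (rect K1 K2)) (~` (val' @^-1` M)).
  by apply: open_nbhs_nbhs; split=> //; exact: closed_openC.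
rewrite nbhsE => -[_ [[V oV <-] Vz] VM].
have [[U1 U2] [/= U1z U2z] UV] : nbhs (z : P) V by exact: open_nbhs_nbhs.
move: U1z U2z; rewrite !nbhsE => -[W1 [oW1 W1z] WU1] [W2 [oW2 W2z] WU2].
have [L1 L1E] := sub _ _ K1 _ oW1; have [L2 L2E] := sub _ _ K2 _ oW2.
have : (rect L1 K2 `|` rect K1 L2) z.
  apply: zA; split.
    exists 2, (fun i => if val i == 0 then L1 else K1),
      (fun i => if val i == 0 then K2 else L2).
    apply/seteqP; split=> [x [Hx|Hx]|x [i _]].
    - by exists ord0.
    - by exists ord_max.
    - by case: ifP => _; [left|right].
  move=> x Mx; have [Kx1 Kx2] := MK _ Mx.
  have [Wx1|Wx1] := pselect (W1 x.1); last by left; rewrite /rect L1E.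
  have [Wx2|Wx2] := pselect (W2 x.2); last by right; rewrite /rect L2E.
  exfalso; apply: (VM (exist _ x (mem_set (MK _ Mx)))) => //.
  by apply: UV; split; [exact: WU1|exact: WU2].
by rewrite /rect L1E L2E => -[[[]]|[_ []]].
Qed.

Lemma prod_members_neq0 : prod_members !=set0.
Proof.
have [L1 /memberC[K1 _]] := members_neq0 C1.
have [L2 /memberC[K2 _]] := members_neq0 C2.
by exists (rect K1 K2); apply/prod_members_union/members_rect.
Qed.

Lemma prod_tau_compact (L : prod_members) :
  compact_hausdorff (space (prod_tau L)).
Proof.
have CL := set_mem (valP L); have [K1 [K2 LK]] := prod_members_sub CL.
split; last exact: (@hausdorff_sub_rect _ K1 K2).
apply: (@embedding_compact (space (prod_tau L)) P val) => //.
rewrite (_ : _ @` _ = (val L : set P)).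
  apply: (@subclosed_compact P _ (rect K1 K2)) => //.
    exact: prod_members_closed.
  exact: compact_rect.
apply/seteqP; split=> [_ [x _ <-]|x Lx]; first exact: set_mem (valP x).
by exists (exist _ x (mem_set Lx)).
Qed.

Lemma prod_members_cover : \bigcup_(K in prod_members) K = [set: X1 * X2].
Proof.
apply/seteqP; split=> // -[x1 x2] _.
have [A1 /memberC[K1 <-] K1x] : (\bigcup_(K in members C1) K) x1.
  by rewrite members_cover.
have [A2 /memberC[K2 <-] K2x] : (\bigcup_(K in members C2) K) x2.
  by rewrite members_cover.
by exists (rect K1 K2) => //; apply/prod_members_union/members_rect.
Qed.

Lemma prod_members_directed (L1 L2 : set (X1 * X2)) :
  prod_members L1 -> prod_members L2 ->
  exists2 L3, prod_members L3 & L1 `|` L2 `<=` L3.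
Proof.
move=> /prod_members_sub[K1 [K2 LK]] /prod_members_sub[M1 [M2 LM]].
have [A1 /memberC[N1 <-] KM1] :=
  members_directed (set_mem (valP K1)) (set_mem (valP M1)).
have [A2 /memberC[N2 <-] KM2] :=
  members_directed (set_mem (valP K2)) (set_mem (valP M2)).
exists (rect N1 N2); first exact/prod_members_union/members_rect.
move=> x [/LK|/LM] [? ?]; split; [apply: KM1|apply: KM2|apply: KM1|apply: KM2];
  by [left|right].
Qed.

Lemma prod_tau_restrict (L1 L2 : prod_members) (sL : val L2 `<=` val L1) :
  @open (space (prod_tau L2)) =
  [set set_incl sL @^-1` U | U in @open (space (prod_tau L1))].
Proof.
apply/seteqP; split=> U.
  by move=> [V oV <-]; exists (val @^-1` V) => //; exists V.
by move=> [_ [V oV <-] <-]; exists V.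
Qed.

Lemma prod_members_compact (L : prod_members) (A : set (space (prod_tau L))) :
  compact A -> prod_members (val @` A).
Proof.
move=> cA; have [K1 [K2 LK]] := prod_members_sub (set_mem (valP L)).
apply: (@compact_sub_rect _ K1 K2).
  by move=> _ [x _ <-]; apply: LK; exact: set_mem (valP x).
apply: continuous_compact cA.
by apply: continuous_subspaceT; exact: initial_continuous.
Qed.

Definition prod_compactology : compactology (X1 * X2)%type :=
  @Compactology (X1 * X2)%type prod_members prod_tau prod_members_neq0
    prod_tau_compact prod_members_cover prod_members_directed
    prod_tau_restrict prod_members_compact.

End Product.

Section SmallestClosedEquivalence.
Variables (X Y : compactological) (f g : X -> Y).

Definition closed_equivalence (R : rel Y) : Prop :=
  equivalence_rel R /\
  closed ([set p | R p.1 p.2] :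
    set (induced_space (prod_compactology (cplgy Y) (cplgy Y)))).

(* Intersection of all closed equivalence relations containing the pairs
   (f z, g z); smallest_closed_equivalenceP shows that it is the smallest one. *)
Definition smallest_closed_equivalence : rel Y := fun x y =>
  `[< forall R : rel Y, closed_equivalence R -> (forall z, R (f z) (g z)) ->
        R x y >].

Lemma smallest_closed_equivalenceP :
  [/\ closed_equivalence smallest_closed_equivalence,
      forall z, smallest_closed_equivalence (f z) (g z) &
      forall R : rel Y, closed_equivalence R -> (forall z, R (f z) (g z)) ->
        forall x y, smallest_closed_equivalence x y -> R x y].
Proof.
split; [split| |].
- move=> x y z; split.
    by apply/asboolP => R [eR _] _; exact: (eR z z z).1.
  move=> /asboolP xy.
  have E R (cR : closed_equivalence R) (Rfg : forall z, R (f z) (g z)) :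
    R x z = R y z := (cR.1 x y z).2 (xy R cR Rfg).
  by apply/asboolP/asboolP => H R cR Rfg; [rewrite -E|rewrite E] => //; exact: H.
- pose F := [set R : rel Y | closed_equivalence R /\ forall z, R (f z) (g z)].
  rewrite (_ : [set p | _] = \bigcap_(R in F) [set p | R p.1 p.2]).
    by apply: closed_bigI => R [[]].
  apply/seteqP; split=> [p /asboolP H R [cR Rfg]|p H]; first exact: H.
  by apply/asboolP => R cR Rfg; exact: H.
- by move=> z; apply/asboolP => R _; exact.
- by move=> R cR Rfg x y /asboolP; exact.
Qed.

Let smallest_refl : reflexive smallest_closed_equivalence.
Proof.
by move=> x; case: smallest_closed_equivalenceP => -[eE _] _ _; case: (eE x x x).
Qed.

Let smallest_sym : symmetric smallest_closed_equivalence.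
Proof.
move=> x y; case: smallest_closed_equivalenceP => -[eE _] _ _.
by apply/idP/idP => xy; [have [_ /(_ xy)<-] := eE x y x|have [_ /(_ xy)<-] := eE y x y];
   exact: smallest_refl.
Qed.

Let smallest_trans : transitive smallest_closed_equivalence.
Proof.
move=> y x z xy; case: smallest_closed_equivalenceP => -[eE _] _ _.
by have [_ /(_ xy)->] := eE x y z.
Qed.

Definition smallest_closed_equiv_rel : equiv_rel Y :=
  EquivRel smallest_closed_equivalence smallest_refl smallest_sym smallest_trans.

End SmallestClosedEquivalence.

(* Main.v *)
(** A map of compactological sets is a morphism iff it preserves members and is
    continuous for the induced topologies, so both parts reduce to identifying
    induced topologies.

    The equalizer is a closed subset of [C], and its induced topology is the
    subspace topology because a set is closed iff it meets every member in a
    member.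

    On [D], the saturation of a member [K] meets a member [L] in the projection
    of the compact set [E `&` (K `*` L)], hence in a member. So [pi] maps
    members to closed sets, which makes the [pi @` K] compact Hausdorff for the quotient
    topology (a continuous closed image of a compact Hausdorff space is
    Hausdorff), and the quotient topology is the induced one. A continuous [h]
    from [D] to a weak Hausdorff space that coequalizes [f] and [g] factors
    through [pi] because its kernel is a closed equivalence relation: [h] maps
    each member onto a Hausdorff space. *)
Require Import Defs.
From mathcomp Require Import all_boot all_classical.
From mathcomp Require Import topology.

Local Open Scope classical_set_scope.
Local Open Scope quotient_scope.

Set Implicit Arguments.
Unset Strict Implicit.

(** * Compactness and separation in topological spaces *)

Section GeneralTopology.
Implicit Types S T Q Z : topologicalType.

Lemma inj_continuous_hausdorff S T (h : S -> T) :
  injective h -> continuous h -> hausdorff_space T -> hausdorff_space S.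
Proof.
move=> injh ch hT p q pq; apply/injh/hT => A B Ahp Bhq.
have [x [Ax Bx]] := pq _ _ (ch _ _ Ahp) (ch _ _ Bhq).
by exists (h x).
Qed.

Lemma closed_eq_hausdorff S T (a b : S -> T) :
  hausdorff_space T -> continuous a -> continuous b ->
  closed [set s | a s = b s].
Proof.
move=> hT ca cb s cls; apply: hT => A B Aas Bbs.
have nA : nbhs s (a @^-1` A) := ca _ _ Aas.
have nB : nbhs s (b @^-1` B) := cb _ _ Bbs.
have [t [ab [At Bt]]] := cls _ (filterI nA nB).
by exists (a t); split=> //; rewrite ab.
Qed.

Lemma set_val_continuous T (A : set T) : continuous (val : A -> T).
Proof. exact: initial_continuous. Qed.

Lemma range_set_val (T : Type) (A : set T) : range (val : A -> T) = A.
Proof.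
apply/seteqP; split=> [_ [x _ <-]|x Ax]; first exact: set_mem (valP x).
by exists (exist _ x (mem_set Ax)).
Qed.

Lemma set_val_image (T : Type) (A B : set T) :
  (val : A -> T) @` (val @^-1` B) = A `&` B.
Proof.
apply/seteqP; split=> [_ [x Bx <-]|x [Ax Bx]].
  by split=> //; exact: set_mem (valP x).
by exists (exist _ x (mem_set Ax)).
Qed.

Lemma compact_set_type T (A : set T) : compact A -> compact [set: A].
Proof.
move=> cA; apply: (@embedding_compact A T val) => //.
by rewrite range_set_val.
Qed.

Lemma compact_image S T (h : S -> T) (A : set S) :
  continuous h -> compact A -> compact (h @` A).
Proof.
by move=> ch; apply: continuous_compact; exact: continuous_subspaceT.
Qed.

Lemma closed_compact_hausdorff S (A : set S) :
  compact_hausdorff S -> closed A -> compact_hausdorff A.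
Proof.
move=> [cS hS] clA; split; last first.
  exact: (@inj_continuous_hausdorff A S val val_inj
    (@set_val_continuous S A) hS).
apply: compact_set_type.
exact: (subclosed_compact clA cS).
Qed.

(** As a subspace, [A] is itself compact Hausdorff, so weak Hausdorffness of [Z] applies to the
    restriction of [h] to [A]. *)
Lemma weak_hausdorff_closed_image S Z (h : S -> Z) (A : set S) :
  compact_hausdorff S -> weak_hausdorff Z -> continuous h -> closed A ->
  closed (h @` A).
Proof.
move=> cS wZ ch clA.
have := wZ A (h \o val) (closed_compact_hausdorff cS clA)
  (continuous_comp_fun ch (@set_val_continuous S A)).
by rewrite (_ : range _ = h @` A) // -[in RHS](range_set_val A) image_comp.
Qed.

(* The images of the complements of two disjoint neighbourhoods of the closed
   fibres, which exist by normality of [S], are closed: their complements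
   separate the two points. *)
Lemma closed_surj_hausdorff S Q (q : S -> Q) :
  compact_hausdorff S -> continuous q -> range q = setT ->
  (forall A, closed A -> closed (q @` A)) -> hausdorff_space Q.
Proof.
move=> [cS hS] cq sq clq; rewrite open_hausdorff => x y xy.
have cl1 (z : Q) : closed (q @^-1` [set z]).
  move/continuous_closedP: cq; apply.
  have [s _ <-] : range q z by rewrite sq.
  by rewrite -image_set1; apply/clq/(compact_closed hS)/compact_set1.
have nxy : set_nbhs (q @^-1` [set x]) (~` (q @^-1` [set y])).
  apply/set_nbhsP; exists (~` (q @^-1` [set y])); split=> //.
    exact/closed_openC/cl1.
  by move=> s /= ->; apply/eqP.
have [B /set_nbhsP[U [oU xU UB]] clB] := compact_normal hS cS (cl1 x) nxy.
exists (~` (q @` ~` U), ~` (q @` closure B)); rewrite /=.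
  split; apply/mem_set => -[s].
    by move=> + qs; apply; apply: xU.
  by move=> /clB.
split; first exact/closed_openC/clq/open_closedC.
  exact/closed_openC/clq/closed_closure.
apply/eqP/seteqP; split=> // z [nU nB].
have [s _ sz] : range q z by rewrite sq.
have [Us|nUs] := pselect (U s); last by apply: nU; exists s.
by apply: nB; exists s => //; exact/subset_closure/UB.
Qed.

(** The corestriction of [h] to its range is a closed continuous surjection, so
    [closed_surj_hausdorff] applies. *)
Lemma closed_range_hausdorff S Z (h : S -> Z) :
  compact_hausdorff S -> continuous h ->
  (forall A, closed A -> closed (h @` A)) -> hausdorff_space (range h).
Proof.
move=> cS ch clh.
have hr s : range h (h s) by exists s.
pose q s : range h := exist _ (h s) (mem_set (hr s)).
apply: (@closed_surj_hausdorff S (range h) q) => //.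
- exact: (@embedding_lift (range h) Z val).
- apply/seteqP; split=> // z _; have [s _ sz] := set_mem (valP z).
  by exists s => //; exact: val_inj.
- move=> A clA; rewrite (_ : q @` A = val @^-1` (h @` A)).
    move/continuous_closedP: (@set_val_continuous Z (range h)); apply.
    exact: clh.
  apply/seteqP; split=> [_ [s As <-]|z [s As sz]]; first by exists s.
  by exists s => //; exact: val_inj.
Qed.

(** Compactness makes [A] closed in the Hausdorff subspace [K], so [A] is the trace on [K] of a
    closed subset of [T]. *)
Lemma compact_sub_closed T (K A : set T) :
  closed K -> hausdorff_space K -> A `<=` K -> compact A -> closed A.
Proof.
move=> clK hK AK cA.
have : @closed K (val @^-1` A).
  apply: compact_closed => //; apply: (@embedding_compact K T val) => //.
  by rewrite set_val_image setIC (setIidl AK).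
move=> /closed_openC[V oV VA].
have -> : A = K `&` ~` V.
  apply/seteqP; split=> x; last first.
    move=> [Kx]; apply: contra_notP => nAx.
    by have : (~` (val @^-1` A)) (exist _ x (mem_set Kx) : K) by []; rewrite -VA.
  move=> Ax; split; first exact: AK.
  move=> Vx; have : (val @^-1` V) (exist _ x (mem_set (AK _ Ax)) : K) by [].
  by rewrite VA; apply.
by apply: closedI => //; exact: open_closedC.
Qed.

End GeneralTopology.

(** * Members as compact and closed sets of the induced topology *)

Section Members.
Variables (X : choiceType) (C : compactology X).
Local Notation T := (induced_space C).

(** The axiom [members_compact] concerns compactness in [tau]; by [val_initial] this is the subspace
    topology, so compactness can be tested in [T]. *)
Lemma members_compact_sub (K A : set X) :
  members C K -> A `<=` K -> compact (A : set T) -> members C A.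
Proof.
move=> /memberC[L <-] AL cA.
have -> : A = val @` (val @^-1` A : set (space (tau C L))).
  by rewrite set_val_image; rewrite setIC; exact/esym/setIidPl.
apply: members_compact; apply: (embedding_compact (val_initial L)).
by rewrite set_val_image setIC (setIidl AL).
Qed.

Lemma members_compact_set (K : set X) : members C K -> compact (K : set T).
Proof. by move=> /memberC[L <-]; exact: compact_val. Qed.

(** A closed part of a member is compact, hence a member; conversely, members are closed in [T], so
    [F] has a closed trace on each of them. *)
Lemma closed_membersP (F : set T) :
  closed F <-> forall K, members C K -> members C (K `&` F).
Proof.
split=> [clF K CK|CF].
  apply: (members_compact_sub CK) => //.
  apply: compact_closedI => //; exact: members_compact_set.
apply/induced_closedP => K.
rewrite (_ : _ @^-1` F = val @^-1` (val K `&` F)).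
  move/continuous_closedP: (@val_continuous _ C K); apply.
  apply: closed_memberT; apply: CF; exact: set_mem (valP K).
apply/seteqP; split=> x /=; last by case.
by split=> //; exact: set_mem (valP x).
Qed.

Lemma members_ub (K L : set X) : members C K -> members C L ->
  exists M : C, K `<=` val M /\ L `<=` val M.
Proof.
move=> CK CL; have [M0 /memberC[M <-]] := members_directed CK CL.
by rewrite subUset => -[]; exists M.
Qed.

End Members.

(** For the converse, [tau] on the image member is initial for its inclusion, so continuity into the
    induced space lifts to the corestriction of [f]. *)
Lemma cmp_morphismP (X Y : compactological) (f : X -> Y) :
  cmp_morphism f <->
  (forall K, members (cplgy X) K -> members (cplgy Y) (f @` K)) /\
  continuous (f : induced_space (cplgy X) -> induced_space (cplgy Y)).
Proof.
split=> [mf|[fK cf] K].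
  split; last exact: cmp_morphism_continuous.
  by move=> _ /memberC[K <-]; have [L [-> _]] := mf K; exact: set_mem (valP L).
have [L LE] := memberC (fK _ (set_mem (valP K))).
exists L; split; first by rewrite LE.
have Lf (x : space (tau (cplgy X) K)) : val L (f (val x)).
  by rewrite LE; exists (val x) => //; exact: set_mem (valP x).
exists (fun x => exist _ (f (val x)) (mem_set (Lf x))); split=> //.
apply: (embedding_lift (val_initial L)).
exact: (continuous_comp_fun cf (@val_continuous _ (cplgy X) K)).
Qed.

Lemma cmp_small_surj (kappa : Type) (X Y : compactological) (f : X -> Y) :
  (forall L, members (cplgy Y) L ->
    exists2 K, members (cplgy X) K & L `<=` f @` K) ->
  cmp_small kappa X -> cmp_small kappa Y.
Proof.
move=> fL sX L; have [_ /memberC[K <-] LK] := fL _ (set_mem (valP L)).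
have [leK ltK] := sX K.
have LleK : ([set: val L] #<= [set: val K])%card.
  rewrite (card_le_eql (card_setT _)) (card_le_eqr (card_setT _)).
  exact: card_le_trans (subset_card_le LK) (card_image_le _ _).
split; first exact: card_le_trans LleK leK.
by move=> kL; apply: ltK; exact: card_le_trans kL LleK.
Qed.

(** Here [K] has the subspace topology of the induced space; the Hausdorff property is pulled back
    along the continuous bijection onto [K] with its [tau]. *)
Lemma compact_hausdorff_member (X : choiceType) (C : compactology X)
    (K : set (induced_space C)) : members C K -> compact_hausdorff K.
Proof.
move=> CK; split; first exact/compact_set_type/members_compact_set.
have [L LK] := memberC CK.
have KL (x : K) : val L (val x) by rewrite LK; exact: set_mem (valP x).
pose h (x : K) : space (tau C L) := exist _ (val x) (mem_set (KL x)).
apply: (@inj_continuous_hausdorff K _ h); last exact: (tau_compact L).2.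
  by move=> x y /(congr1 val) /= /val_inj.
apply: (embedding_lift (val_initial L)).
exact: (@set_val_continuous (induced_space C) K).
Qed.

(** * Compactologies whose members are subspaces of a given space *)

(* A compactology on [X] mentions the choice structure of [X], which need not be
   convertible to the one bundled with a topology on [X]: hence the separate
   [X] and [t]. *)
Section SubspaceCompactology.
Variables (X : choiceType) (t : topology_on X).
Local Notation T := (space t).
Variable M : set (set T).
Hypotheses (M_neq0 : M !=set0)
  (M_compact : forall K, M K -> compact_hausdorff K)
  (M_cover : \bigcup_(K in M) K = [set: T])
  (M_directed : forall K1 K2, M K1 -> M K2 ->
    exists2 K3, M K3 & K1 `|` K2 `<=` K3)
  (M_sub : forall K A, M K -> A `<=` K -> compact A -> M A).

Definition subspace_tau (K : M) : topology_on (val K) :=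
  Topological.on (set_type (val K : set T)).

Lemma subspace_tau_compact (K : M) : compact_hausdorff (space (subspace_tau K)).
Proof. exact: M_compact (set_mem (valP K)). Qed.

Lemma subspace_tau_restrict (K1 K2 : M) (sK : val K2 `<=` val K1) :
  @open (space (subspace_tau K2)) =
  [set set_incl sK @^-1` U | U in @open (space (subspace_tau K1))].
Proof.
apply/seteqP; split=> U.
  by move=> [V oV <-]; exists (val @^-1` V) => //; exists V.
by move=> [_ [V oV <-] <-]; exists V.
Qed.

Lemma subspace_members_compact (K : M) (A : set (space (subspace_tau K))) :
  compact A -> M (val @` A).
Proof.
move=> cA; apply: (M_sub (set_mem (valP K))).
  by move=> _ [x _ <-]; exact: set_mem (valP x).
exact: (@compact_image (val K) T val _ (@set_val_continuous T (val K))).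
Qed.

Definition subspace_compactology : compactology X :=
  @Compactology X M subspace_tau M_neq0 subspace_tau_compact M_cover M_directed
    subspace_tau_restrict subspace_members_compact.

Lemma continuous_from_subspace :
  continuous (id : induced_space subspace_compactology -> T).
Proof. by apply/continuousP => U oU; apply/induced_openP => K; exists U. Qed.

(** The hypothesis makes the topology of [T] final for the subspaces in [M]. Together with
    [continuous_from_subspace], it identifies that topology with the induced one. *)
Lemma continuous_to_subspace :
  (forall U : set T,
    (forall K, M K -> @open K (val @^-1` U)) -> open U) ->
  continuous (id : T -> induced_space subspace_compactology).
Proof.
move=> TM; apply/continuousP => U /induced_openP oU; apply: TM => K MK.
exact: oU (exist _ K (mem_set MK)).
Qed.

End SubspaceCompactology.

(** * Closed relations for the product compactology *)

Section Product.
Variables Y : compactological.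
Local Notation T := (induced_space (cplgy Y)).
Local Notation TT := (induced_space (prod_compactology (cplgy Y) (cplgy Y))).

(** The target is the topological product, whose topology may be coarser than that of [TT]; this
    makes both coordinates continuous on each member. *)
Lemma prod_member_continuous (L : prod_compactology (cplgy Y) (cplgy Y)) :
  continuous (val : space (tau _ L) -> T * T).
Proof. exact: (@set_val_continuous (T * T)%type (val L)). Qed.

(** Closedness is tested on a member [L]. Both projections of [L] lie in one member [M], whose image
    under [h] is Hausdorff, and the trace of the kernel on [L] is the coincidence set of two
    continuous maps into that image. *)
Lemma kernel_closed (Z : topologicalType) (h : T -> Z) :
  weak_hausdorff Z -> continuous h ->
  closed ([set p | h p.1 = h p.2] : set TT).
Proof.
move=> wZ ch; apply/induced_closedP => L.
have [K1 [K2 LK]] := prod_members_sub (set_mem (valP L)).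
have [M [KM1 KM2]] := members_ub (set_mem (valP K1)) (set_mem (valP K2)).
pose hM : space (tau (cplgy Y) M) -> Z := h \o val.
have chM : continuous hM.
  exact: (continuous_comp_fun ch (@val_continuous _ (cplgy Y) M)).
have hR : hausdorff_space (range hM).
  apply: closed_range_hausdorff => //; first exact: tau_compact.
  by move=> A; apply: weak_hausdorff_closed_image => //; exact: tau_compact.
have rM y : val M y -> range hM (h y).
  by move=> My; exists (exist _ y (mem_set My)).
pose S := space (tau (prod_compactology (cplgy Y) (cplgy Y)) L).
have r1 (x : S) : range hM (h (val x).1).
  by apply/rM/KM1; have [] := LK _ (set_mem (valP x)).
have r2 (x : S) : range hM (h (val x).2).
  by apply/rM/KM2; have [] := LK _ (set_mem (valP x)).
pose a x : range hM := exist _ (h (val x).1) (mem_set (r1 x)).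
pose b x : range hM := exist _ (h (val x).2) (mem_set (r2 x)).
rewrite (_ : _ @^-1` _ = [set x | a x = b x]); last first.
  by apply/seteqP; split=> x /= [] // hx; exact: val_inj.
apply: (@closed_eq_hausdorff S (range hM)) => //.
  apply: (@embedding_lift (range hM) Z val) => //.
  apply: (continuous_comp_fun ch).
  exact: (continuous_comp_fun (@continuous_fst T T)
    (@prod_member_continuous L)).
apply: (@embedding_lift (range hM) Z val) => //.
apply: (continuous_comp_fun ch).
exact: (continuous_comp_fun (@continuous_snd T T) (@prod_member_continuous L)).
Qed.

(** The set is the second projection of the trace of [E] on the rectangle of [K] and [L], which is
    compact. *)
Lemma saturation_member (E : set TT) (K L : set Y) :
  closed E -> members (cplgy Y) K -> members (cplgy Y) L ->
  members (cplgy Y) [set y | L y /\ exists2 x, K x & E (x, y)].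
Proof.
move=> clE /memberC[K' <-] /memberC[L' L'E]; rewrite -L'E.
apply: (members_compact_sub (set_mem (valP L'))) => [y []//|].
have [P PE] : {P : prod_compactology (cplgy Y) (cplgy Y) | val P = rect K' L'}.
  exact/memberC/prod_members_union/members_rect.
pose F : set (space (tau (prod_compactology (cplgy Y) (cplgy Y)) P)) :=
  val @^-1` E.
have cF : compact F.
  have clF : closed F by move/induced_closedP: clE.
  exact: (subclosed_compact clF (tau_compact P).1).
have := compact_image (continuous_comp_fun (@continuous_snd T T)
  (@prod_member_continuous P)) cF.
congr compact; apply/seteqP; split=> [_ [p Ep <-]|y [Ly [x Kx Exy]]].
  have : rect K' L' (val p) by rewrite -PE; exact: set_mem (valP p).
  move=> [K1 L2]; split=> //; exists (val p).1 => //.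
  by rewrite -surjective_pairing.
have Pxy : val P (x, y) by rewrite PE.
by exists (exist _ (x, y) (mem_set Pxy)).
Qed.

End Product.

(** * The compactology on a closed subset *)

Section ClosedSubset.
Variables (X : choiceType) (C : compactology X) (A : set X).
Hypothesis clA : closed (A : set (induced_space C)).
Local Notation T := (set_type (A : set (induced_space C))).

Definition sub_members : set (set T) := [set B | members C (val @` B)].

(** Closedness of [A] enters here: it makes the intersection of [A] and [K] a member. *)
Lemma sub_members_preimage (K : set X) :
  members C K -> sub_members (val @^-1` K).
Proof.
move=> CK; rewrite /sub_members /= set_val_image setIC.
by move/closed_membersP: clA; apply.
Qed.

Lemma sub_members_neq0 : sub_members !=set0.
Proof.
have [K CK] := members_neq0 C.
by exists (val @^-1` K); exact: sub_members_preimage.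
Qed.

Lemma sub_members_compact (B : set T) : sub_members B -> compact_hausdorff B.
Proof.
move=> CB; have [cB hB] := compact_hausdorff_member CB; split.
  apply: compact_set_type.
  apply: (@embedding_compact T (induced_space C) val) => //.
  exact: members_compact_set.
have Bv (x : B) : (val @` B) (val (val x)).
  by exists (val x) => //; exact: set_mem (valP x).
pose h (x : B) : [set val y | y in B] := exist _ (val (val x)) (mem_set (Bv x)).
apply: (@inj_continuous_hausdorff B [set val y | y in B] h) => //.
  by move=> x y /(congr1 val) /= /val_inj /val_inj.
apply: (@embedding_lift [set val y | y in B] (induced_space C) val) => //.
exact: (continuous_comp_fun (@set_val_continuous (induced_space C) A)
  (@set_val_continuous T B)).
Qed.

Lemma sub_members_cover : \bigcup_(K in sub_members) K = [set: T].
Proof.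
apply/seteqP; split=> // x _.
have [K CK Kx] : (\bigcup_(K in members C) K) (val x) by rewrite members_cover.
by exists (val @^-1` K) => //; exact: sub_members_preimage.
Qed.

Lemma sub_members_directed (K1 K2 : set T) :
  sub_members K1 -> sub_members K2 ->
  exists2 K3, sub_members K3 & K1 `|` K2 `<=` K3.
Proof.
move=> CK1 CK2; have [K CK KU] := members_directed CK1 CK2.
exists (val @^-1` K); first exact: sub_members_preimage.
by move=> x Kx; apply: KU; case: Kx => Kx; [left|right]; exists x.
Qed.

Lemma sub_members_sub (K B : set T) :
  sub_members K -> B `<=` K -> compact B -> sub_members B.
Proof.
move=> CK BK cB; apply: (members_compact_sub CK); first exact: image_subset.
exact: (@compact_image T (induced_space C) val _
  (@set_val_continuous (induced_space C) A)).
Qed.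

Definition sub_compactology : compactology A :=
  @subspace_compactology A (Topological.on T) _ sub_members_neq0
    sub_members_compact sub_members_cover sub_members_directed sub_members_sub.

(** If [U] is open on every member, its complement in [A] is closed already in the ambient space, so
    [U] is open in the subspace topology. *)
Lemma continuous_to_sub : continuous (id : T -> induced_space sub_compactology).
Proof.
refine (@continuous_to_subspace A (Topological.on T) _ _ _ _ _ _ _).
move=> U oU; rewrite -closedC.
pose F : set (induced_space C) := (val : T -> induced_space C) @` (~` U).
have clF : closed F.
  apply/closed_membersP => K CK.
  (* The trace of [F] on [K] is the image of a closed subset of the member [K'], hence a member of
     [C]. *)
  have [K' K'E] : {K' : sub_compactology | val K' = val @^-1` K}.
    exact/memberC/sub_members_preimage.
  have := @closed_member _ _ K' _ (open_closedC (oU _ (set_mem (valP K')))).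
  rewrite preimage_setC set_val_image K'E /= /sub_members /=.
  congr (members C); apply/seteqP.
  split=> [_ [x [Kx nUx] <-]|x [Kx [y nUy yx]]].
    by split=> //; exists x.
  by exists y => //; split=> //; rewrite /= yx.
rewrite (_ : ~` U = val @^-1` F).
  move/continuous_closedP: (@set_val_continuous (induced_space C) A); apply.
  exact: clF.
by apply/seteqP; split=> [x nUx|x [y nUy /val_inj <-] //]; exists x.
Qed.

Lemma sub_incl_continuous :
  continuous (val : induced_space sub_compactology -> induced_space C).
Proof.
apply: (@continuous_comp_fun (induced_space sub_compactology) T
  (induced_space C) val id (@set_val_continuous (induced_space C) A)).
exact: (@continuous_from_subspace A (Topological.on T) _ _ _ _ _ _).
Qed.

End ClosedSubset.

(** * The quotient by a closed equivalence relation *)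

Section ClosedQuotient.
Variables (Y : compactological) (E : equiv_rel Y).
Local Notation T := (induced_space (cplgy Y)).
Hypothesis clE : closed ([set p | E p.1 p.2] :
  set (induced_space (prod_compactology (cplgy Y) (cplgy Y)))).
Local Notation Q := (@quotient_topology T {eq_quot E}).
Local Notation pi := (\pi_{eq_quot E} : T -> Q).

Lemma quot_pi_continuous : continuous pi.
Proof. exact: (@pi_continuous T {eq_quot E}). Qed.

Lemma quot_piP (x y : Y) : pi x = pi y <-> E x y.
Proof. by split=> [/eqquotP|xy]; last exact/eqquotP. Qed.

Lemma quot_pi_surj (q : Q) : exists x, pi x = q.
Proof. by exists (repr (q : {eq_quot E})); exact: reprK. Qed.

(** In the quotient topology this means that the saturation of [K] is closed, and
    [saturation_member] gives its trace on every member. *)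
Lemma closed_quot_image (K : set Y) :
  members (cplgy Y) K -> closed (pi @` K : set Q).
Proof.
move=> CK; rewrite -openC.
suff : closed (pi @^-1` (pi @` K)) by move/closed_openC; rewrite preimage_setC.
apply/closed_membersP => L CL.
have := saturation_member clE CK CL; congr (members _).
apply/seteqP; split=> y [Ly [x Kx]].
  by move=> Exy; split=> //; exists x => //; exact/quot_piP.
by move=> /quot_piP Exy; split=> //; exists x.
Qed.

Definition quot_members : set (set Q) :=
  [set pi @` K | K in members (cplgy Y)].

Lemma range_pi_val (K : cplgy Y) :
  range (pi \o (val : space (tau (cplgy Y) K) -> T)) = pi @` (val K).
Proof. by rewrite -[in RHS](range_set_val (val K)) image_comp. Qed.

Lemma quot_members_compact (K : set Q) : quot_members K -> compact_hausdorff K.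
Proof.
move=> [L CL <-]; split.
  apply/compact_set_type/(compact_image quot_pi_continuous).
  exact: members_compact_set.
have [K' K'E] := memberC CL; rewrite -K'E -range_pi_val.
apply: closed_range_hausdorff; first exact: tau_compact.
  exact: (continuous_comp_fun quot_pi_continuous (@val_continuous _ _ K')).
(* A closed subset of [K'] is again a member, so its image is closed. *)
by move=> A clA; rewrite -image_comp; exact/closed_quot_image/closed_member.
Qed.

Lemma quot_members_neq0 : quot_members !=set0.
Proof.
by have [K CK] := members_neq0 (cplgy Y); exists (pi @` K); exists K.
Qed.

Lemma quot_members_cover : \bigcup_(K in quot_members) K = [set: Q].
Proof.
apply/seteqP; split=> // q _; have [x <-] := quot_pi_surj q.
have [K CK Kx] : (\bigcup_(K in members (cplgy Y)) K) x.
  by rewrite members_cover.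
by exists (pi @` K); [exists K|exists x].
Qed.

Lemma quot_members_directed (K1 K2 : set Q) :
  quot_members K1 -> quot_members K2 ->
  exists2 K3, quot_members K3 & K1 `|` K2 `<=` K3.
Proof.
move=> [L1 CL1 <-] [L2 CL2 <-]; have [L CL LU] := members_directed CL1 CL2.
exists (pi @` L); first by exists L.
by rewrite -image_setU; exact: image_subset.
Qed.

Lemma quot_members_sub (K A : set Q) :
  quot_members K -> A `<=` K -> compact A -> quot_members A.
Proof.
move=> QK AK cA; have [L CL LK] := QK.
have clA : closed A.
  apply: (@compact_sub_closed _ K) => //;
    last exact: (quot_members_compact QK).2.
  by rewrite -LK; exact: closed_quot_image.
(* The part of [L] above [A] is a member because [A] is closed in [Q], and it maps onto [A] because
   [A] lies in the image of [L]. *)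
exists (L `&` pi @^-1` A).
  have : closed (pi @^-1` A).
    by move/continuous_closedP: quot_pi_continuous; apply.
  by move/closed_membersP; apply.
apply/seteqP; split=> [_ [x [_ Ax] <-] //|q Aq].
have := AK _ Aq; rewrite -LK => -[x Lx xq]; exists x => //.
by split=> //; rewrite /= xq.
Qed.

Definition quot_compactology : compactology {eq_quot E} :=
  @subspace_compactology {eq_quot E} (Topological.on Q) _ quot_members_neq0
    quot_members_compact quot_members_cover quot_members_directed
    quot_members_sub.

(** On each member [K], the projection factors continuously through the subspace [L], so a set open
    on every [L] has an open preimage in [Y]; this is openness in the quotient. *)
Lemma continuous_to_quot :
  continuous (id : Q -> induced_space quot_compactology).
Proof.
refine (@continuous_to_subspace {eq_quot E} (Topological.on Q) _ _ _ _ _ _ _).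
move=> U oU; apply/induced_openP => K.
pose L : set Q := pi @` val K.
have Lx (x : space (tau (cplgy Y) K)) : L (pi (val x)).
  by exists (val x) => //; exact: set_mem (valP x).
pose q (x : space (tau (cplgy Y) K)) : L :=
  exist _ (pi (val x)) (mem_set (Lx x)).
have /continuousP cq : continuous q.
  apply: (@embedding_lift L Q val) => //.
  exact: (continuous_comp_fun quot_pi_continuous (@val_continuous _ _ K)).
apply: (cq (val @^-1` U)); apply: oU; exists (val K) => //.
exact: set_mem (valP K).
Qed.

End ClosedQuotient.

(** * Equalizers *)

Section Equalizer.
Variables (X Y : compactological) (f g : cmp_hom X Y).
Local Notation TX := (induced_space (cplgy X)).
Local Notation TY := (induced_space (cplgy Y)).

(** The induced space of [Y] is only weak Hausdorff, so the test is made on each member [K]: both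
    images of [K] lie in one member [M], which is Hausdorff. *)
Lemma closed_equalizer : closed ([set x | sval f x = sval g x] : set TX).
Proof.
apply/induced_closedP => K.
have [/(_ _ (set_mem (valP K))) fK cf] := (cmp_morphismP _).1 (svalP f).
have [/(_ _ (set_mem (valP K))) gK cg] := (cmp_morphismP _).1 (svalP g).
have [M [fM gM]] := members_ub fK gK.
pose S := space (tau (cplgy X) K).
have Mf (x : S) : val M (sval f (val x)).
  by apply: fM; exists (val x) => //; exact: set_mem (valP x).
have Mg (x : S) : val M (sval g (val x)).
  by apply: gM; exists (val x) => //; exact: set_mem (valP x).
pose a (x : S) : space (tau (cplgy Y) M) :=
  exist _ (sval f (val x)) (mem_set (Mf x)).
pose b (x : S) : space (tau (cplgy Y) M) :=
  exist _ (sval g (val x)) (mem_set (Mg x)).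
rewrite (_ : _ @^-1` _ = [set x | a x = b x]); last first.
  by apply/seteqP; split=> x /= [] // fg; exact: val_inj.
apply: closed_eq_hausdorff; first exact: (tau_compact M).2.
  apply: (embedding_lift (val_initial M)).
  exact: (continuous_comp_fun cf (@val_continuous _ _ K)).
apply: (embedding_lift (val_initial M)).
exact: (continuous_comp_fun cg (@val_continuous _ _ K)).
Qed.

Definition equalizer_compactology :
    compactology [set x | sval f x = sval g x] :=
  sub_compactology closed_equalizer.

Local Notation Eq := (Compactological equalizer_compactology).

Lemma equalizer_incl_morphism : @cmp_morphism Eq X val.
Proof.
apply/cmp_morphismP; split=> [K //|].
exact: (@sub_incl_continuous _ _ _ closed_equalizer).
Qed.

Definition equalizer_incl : cmp_hom Eq X := exist _ val equalizer_incl_morphism.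

(** Allowing any space [Z] serves the universal properties in [Cmp] and in [CGWH] alike. *)
Lemma equalizer_lift_continuous (Z : topologicalType) (h : Z -> TX)
    (fgh : forall z, sval f (h z) = sval g (h z)) :
  continuous h ->
  continuous ((fun z => exist _ (h z) (mem_set (fgh z))) :
    Z -> induced_space equalizer_compactology).
Proof.
move=> ch.
apply: (continuous_comp_fun (@continuous_to_sub _ _ _ closed_equalizer)).
exact: (@embedding_lift (set_type ([set x | sval f x = sval g x] : set TX))
  TX val).
Qed.

Lemma is_equalizer_cmp : @is_equalizer Cmp X Y f g Eq equalizer_incl.
Proof.
split; first by apply: cmp_homP => x; exact: set_mem (valP x).
move=> Z h fgh.
have fghz z : sval f (sval h z) = sval g (sval h z).
  exact: (congr1 (fun k : cmp_hom Z Y => sval k z) fgh).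
have mu : @cmp_morphism Z Eq (fun z => exist _ (sval h z) (mem_set (fghz z))).
  have [hK ch] := (cmp_morphismP _).1 (svalP h).
  apply/cmp_morphismP; split; last exact: equalizer_lift_continuous.
  move=> K CK; have := hK _ CK.
  (* Members of the equalizer are recognized by their image in [X], which is here the image of [K]
     under [h]. *)
  by rewrite /= /sub_members /= image_comp.
exists (exist _ _ mu); split; first exact: cmp_homP.
move=> u hu; apply: cmp_homP => z; apply: val_inj => /=.
by rewrite -hu.
Qed.

Lemma is_equalizer_top :
  @is_equalizer CGWH (to_top X) (to_top Y)
    (@fmor Cmp CGWH to_top X Y f) (@fmor Cmp CGWH to_top X Y g)
    (to_top Eq) (@fmor Cmp CGWH to_top Eq X equalizer_incl).
Proof.
split; first by apply: top_homP => x; exact: set_mem (valP x).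
move=> [Z cgwhZ] h fgh.
have fghz z : sval f (sval h z) = sval g (sval h z).
  exact: (congr1 (fun k : top_hom Z TY => sval k z) fgh).
have cu := @equalizer_lift_continuous Z (sval h) fghz (svalP h).
exists (exist _ _ cu); split; first exact: top_homP.
move=> u hu; apply: top_homP => z; apply: val_inj => /=.
by rewrite -hu.
Qed.

Lemma equalizer_members :
  [set K `&` [set x | sval f x = sval g x] | K in members (cplgy X)] =
  [set K | members (cplgy X) K /\ K `<=` [set x | sval f x = sval g x]].
Proof.
apply/seteqP; split=> [_ [K CK <-]|K [CK KE]].
  by split=> [|x []//]; move/closed_membersP: closed_equalizer; apply.
by exists K => //; exact: setIidl.
Qed.

Lemma equalizer_compactologyE :
  [set val @` K | K in members equalizer_compactology] =
  [set K `&` [set x | sval f x = sval g x] | K in members (cplgy X)].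
Proof.
rewrite equalizer_members; apply/seteqP; split=> [_ [K CK <-]|K [CK KE]].
  by split=> // _ [x _ <-]; exact: set_mem (valP x).
exists (val @^-1` K); last by rewrite set_val_image setIC; exact: setIidl.
exact: sub_members_preimage closed_equalizer _ CK.
Qed.

(** A member of the equalizer is equipotent to its image under [val], a member of [X]. *)
Lemma equalizer_small (kappa : Type) : cmp_small kappa X -> cmp_small kappa Eq.
Proof.
move=> sX K; have CK : members (cplgy X) (val @` val K) := set_mem (valP K).
have [L LE] := memberC CK; have [leL ltL] := sX L.
have KL : ([set: val K] #= [set: val L])%card.
  rewrite (card_eql (card_setT _)) (card_eqr (card_setT _)) LE card_eq_sym.
  exact: (@inj_card_eq _ _ _ val (in2W val_inj)).
by split; [rewrite (card_le_eql KL)|rewrite (card_le_eqr KL)].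
Qed.

End Equalizer.

(** * Coequalizers *)

Section Coequalizer.
Variables (X Y : compactological) (f g : cmp_hom X Y).
Local Notation TX := (induced_space (cplgy X)).
Local Notation TY := (induced_space (cplgy Y)).
Local Notation E := (smallest_closed_equiv_rel (sval f) (sval g)).
Local Notation pi := (\pi_{eq_quot E} : Y -> {eq_quot E}).

Lemma closed_smallest : closed ([set p | E p.1 p.2] :
  set (induced_space (prod_compactology (cplgy Y) (cplgy Y)))).
Proof. by have [[]] := smallest_closed_equivalenceP (sval f) (sval g). Qed.

Definition coequalizer_compactology : compactology {eq_quot E} :=
  quot_compactology closed_smallest.

Local Notation Coeq := (Compactological coequalizer_compactology).

Lemma coequalizer_proj_morphism : @cmp_morphism Y Coeq pi.
Proof.
apply/cmp_morphismP; split=> [K CK|]; first by exists K.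
exact: (continuous_comp_fun (@continuous_to_quot _ _ closed_smallest)
  (@quot_pi_continuous _ E)).
Qed.

Definition coequalizer_proj : cmp_hom Y Coeq :=
  exist _ pi coequalizer_proj_morphism.

Lemma coequalizer_proj_eq x :
  sval coequalizer_proj (sval f x) = sval coequalizer_proj (sval g x).
Proof.
apply/quot_piP; have [_ + _] := smallest_closed_equivalenceP (sval f) (sval g).
exact.
Qed.

(** This is the common core of both universal properties: minimality of [E] places it inside the
    closed kernel of [h], so [h] descends. *)
Lemma coequalizer_desc (Z : topologicalType) (h : TY -> Z) :
  weak_hausdorff Z -> continuous h ->
  (forall x, h (sval f x) = h (sval g x)) ->
  exists2 u : Coeq -> Z, (forall y, u (pi y) = h y) &
    continuous (u : induced_space coequalizer_compactology -> Z).
Proof.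
move=> wZ ch hfg.
pose R : rel Y := fun x y => `[< h x = h y >].
have hE x y : E x y -> h x = h y.
  have [_ _ min] := smallest_closed_equivalenceP (sval f) (sval g).
  move=> Exy; suff /asboolP : R x y by [].
  apply: min Exy; last by move=> z; exact/asboolP.
  split.
    move=> a b c; split; first exact/asboolP.
    by move=> /asboolP ab; rewrite /R ab.
  rewrite (_ : [set p | R p.1 p.2] = [set p | h p.1 = h p.2]).
    exact: kernel_closed.
  by apply/seteqP; split=> p /asboolP.
(* The chosen representative does not matter, since [h] is constant on the classes of [E]. *)
pose u (q : {eq_quot E}) := h (repr q).
have up y : u (pi y) = h y by apply/hE/quot_piP; exact: reprK.
exists u => //.
have cu : continuous (u : @quotient_topology TY {eq_quot E} -> Z).
  by apply/quotient_continuous; rewrite (_ : u \o _ = h) //; exact/funext.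
(* Continuity for the quotient topology passes to the induced topology through the continuous
   identity map. *)
apply: (@continuous_comp_fun (induced_space coequalizer_compactology)
  (@quotient_topology TY {eq_quot E}) Z u id cu).
exact: (@continuous_from_subspace {eq_quot E}
  (Topological.on (@quotient_topology TY {eq_quot E})) _ _ _ _ _ _).
Qed.

Lemma is_coequalizer_cmp : @is_coequalizer Cmp X Y f g Coeq coequalizer_proj.
Proof.
split; first by apply: cmp_homP => x; exact: coequalizer_proj_eq.
move=> Z h hfg.
have hfgx x : sval h (sval f x) = sval h (sval g x).
  exact: (congr1 (fun k : cmp_hom X Z => sval k x) hfg).
have [hK ch] := (cmp_morphismP _).1 (svalP h).
(* The induced space of [Z] is weak Hausdorff, so the topological descent already yields the map in
   [Cmp]. *)
have [u up cu] :=
  coequalizer_desc (@induced_weak_hausdorff _ (cplgy Z)) ch hfgx.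
have mu : @cmp_morphism Coeq Z u.
  apply/cmp_morphismP; split=> // _ [K CK <-].
  have := hK _ CK; rewrite image_comp; congr members.
  by apply: eq_imagel => y _ /=.
exists (exist _ u mu); split; first exact: cmp_homP.
move=> v hv; apply: cmp_homP => q /=; have [y <-] := @quot_pi_surj _ E q.
by rewrite up -hv.
Qed.

Lemma is_coequalizer_top :
  @is_coequalizer CGWH (to_top X) (to_top Y)
    (@fmor Cmp CGWH to_top X Y f) (@fmor Cmp CGWH to_top X Y g)
    (to_top Coeq) (@fmor Cmp CGWH to_top Y Coeq coequalizer_proj).
Proof.
split; first by apply: top_homP => x; exact: coequalizer_proj_eq.
move=> [Z [cgZ wZ]] h hfg.
have hfgx x : sval h (sval f x) = sval h (sval g x).
  exact: (congr1 (fun k : top_hom TX Z => sval k x) hfg).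
have [u up cu] := coequalizer_desc wZ (svalP h) hfgx.
exists (exist _ u cu); split; first exact: top_homP.
move=> v hv; apply: top_homP => q /=; have [y <-] := @quot_pi_surj _ E q.
by rewrite up -hv.
Qed.

Lemma coequalizer_small (kappa : Type) :
  cmp_small kappa Y -> cmp_small kappa Coeq.
Proof.
apply: (@cmp_small_surj _ Y Coeq (sval coequalizer_proj)) => _ [K CK <-].
by exists K.
Qed.

End Coequalizer.

Theorem proposition2p18 (kappa : Type)
    (kappa_uncountable : uncountable_card kappa)
    (kappa_strong_limit : strong_limit_card kappa)
    (C D : Cmp_lt kappa) (f g : hom C D) :
  let XC : compactological := sval C in
  let XD : compactological := sval D in
  (let X : set XC := [set x | sval f x = sval g x] in
   [set K `&` X | K in members (cplgy XC)] =
     [set K | members (cplgy XC) K /\ K `<=` X] /\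
   exists Eq : compactology X,
     [set val @` K | K in members Eq] =
       [set K `&` X | K in members (cplgy XC)] /\
   exists (Eq_small : cmp_small kappa (Compactological Eq))
          (i : cmp_hom (Compactological Eq) XC),
     [/\ forall x : X, sval i x = val x,
         @is_equalizer (Cmp_lt kappa) C D f g
           (exist _ (Compactological Eq) Eq_small) i,
         @is_equalizer Cmp XC XD f g (Compactological Eq) i &
         @is_equalizer CGWH (to_top XC) (to_top XD)
           (@fmor Cmp CGWH to_top XC XD f) (@fmor Cmp CGWH to_top XC XD g)
           (to_top (Compactological Eq))
           (@fmor Cmp CGWH to_top (Compactological Eq) XC i)])
  /\
  (let E : equiv_rel XD := smallest_closed_equiv_rel (sval f) (sval g) in
   let X : choiceType := {eq_quot E} in
   let pi : XD -> X := \pi_{eq_quot E} in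
   exists Coeq : compactology X,
     members Coeq = [set pi @` K | K in members (cplgy XD)] /\
   exists (Coeq_small : cmp_small kappa (Compactological Coeq))
          (p : cmp_hom XD (Compactological Coeq)),
     [/\ forall x : XD, sval p x = pi x,
         @is_coequalizer (Cmp_lt kappa) C D f g
           (exist _ (Compactological Coeq) Coeq_small) p,
         @is_coequalizer Cmp XC XD f g (Compactological Coeq) p &
         @is_coequalizer CGWH (to_top XC) (to_top XD)
           (@fmor Cmp CGWH to_top XC XD f) (@fmor Cmp CGWH to_top XC XD g)
           (to_top (Compactological Coeq))
           (@fmor Cmp CGWH to_top XD (Compactological Coeq) p)]).
Proof.
move=> XC XD; split.
  split; first exact: equalizer_members.
  exists (equalizer_compactology f g); split.
    exact: equalizer_compactologyE.
  exists (@equalizer_small XC XD f g kappa (svalP C)), (equalizer_incl f g).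
  have [fg UP] := is_equalizer_cmp f g.
  split=> //; last exact: is_equalizer_top.
  (* [Cmp_lt kappa] is a full subcategory containing the object just built, so the universal
     property restricts to it. *)
  by split=> // -[Z sZ]; exact: UP.
move=> E X pi.
exists (coequalizer_compactology f g); split=> //.
exists (@coequalizer_small XC XD f g kappa (svalP D)), (coequalizer_proj f g).
have [fg UP] := is_coequalizer_cmp f g.
split=> //; last exact: is_coequalizer_top.
by split=> // -[Z sZ]; exact: UP.
Qed.
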